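(* There exists a Hilbert set $H\subseteq\mathbb N$ which is a Lust-Piquard set (as a subset of $\mathbb Z=\hat{\mathbb T}$).
   Context: A set $H\subseteq\mathbb Z$ is a Hilbert set if there exist two sequences of integers $(p_n)_{n\ge1}$ and $(q_n)_{n\ge1}$, with $q_n\neq0$ for all $n$, such that $$H=\bigcup_{n\ge1}\Big\{p_n+\sum_{k=1}^n\varepsilon_kq_k:\ \varepsilon_1,\dots,\varepsilon_n\in\{0,1\}\Big\}.$$ Let $G$ be a compact abelian group with dual group $\Gamma=\hat G$ (written additively, so that $-\gamma$ is the character $\overline\gamma$); here $G=\mathbb T=\mathbb R/2\pi\mathbb Z$ and $\Gamma=\mathbb Z$, the integer $n$ being identified with the character $t\mapsto e^{int}$. An invariant mean on $L^\infty(G)$ is a continuous linear functional $M$ on $L^\infty(G)$ with $M(\mathbf 1)=\|M\|=1$ and $M(f_x)=M(f)$ for every $f\in L^\infty(G)$ and $x\in G$, where $f_x$ is the translate of $f$ by $x$. A function $f\in L^\infty(G)$ has a unique invariant mean if $M(f)=\hat f(0)$ for every invariant mean $M$ on $L^\infty(G)$. For $\Lambda\subseteq\Gamma$, $L^\infty_\Lambda$ is the space of $f\in L^\infty(G)$ with $\hat f(\gamma)=0$ for all $\gamma\notin\Lambda$. $\Lambda\subseteq\Gamma$ is a Lust-Piquard set if $\gamma f$ has a unique invariant mean for every $f\in L^\infty_\Lambda$ and every $\gamma\in\Gamma$; equivalently, $M(\gamma f)=\hat f(-\gamma)$ for every invariant mean $M$, every $f\in L^\infty_\Lambda$ and every $\gamma\in\Gamma$.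 *)

(* Defs.v *)
From HB Require Import structures.
From mathcomp Require Import all_boot all_order all_algebra.
From mathcomp Require Import all_classical all_reals all_analysis.
From mathcomp Require Import measurable_realfun ess_sup_inf complex.

Set Implicit Arguments.
Unset Strict Implicit.
Unset Printing Implicit Defensive.

Import Order.TTheory GRing.Theory Num.Theory.
Import numFieldNormedType.Exports.
Import Normc.

Local Open Scope classical_set_scope.
Local Open Scope ring_scope.
Local Open Scope complex_scope.

Definition hilbert_set (H : set int) : Prop :=
  exists p q : nat -> int,
    (forall n, (1 <= n)%N -> q n != 0) /\
    H = \bigcup_(n in [set n | (1 <= n)%N])
          [set p n + \sum_(1 <= k < n.+1) (eps k)%:R * q k
             | eps in [set: nat -> bool]].

Section Linf.
Variable R : realType.
Local Notation C := R[i].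
Local Notation Re := (@complex.Re R).
Local Notation Im := (@complex.Im R).
Local Notation mu := (@lebesgue_measure R).

(* Functions on the circle R / 2 pi Z are 2 pi-periodic functions on R; the
   null sets of the normalized Haar measure correspond to the periodic
   Lebesgue-null subsets of R, so the essential supremum may be taken on R.
   The elements of [Linf] below are functions, not classes modulo almost
   everywhere equality, and [linf_norm] is thus a seminorm on it. *)
Definition linf_norm (f : R -> C) : \bar R :=
  Lnorm mu +oo (fun t => (normc (f t))%:E).

Definition linf : {pred R -> C^o} := mem [set f : R -> C |
  [/\ periodic f (pi *+ 2),
      measurable_fun [set: R] (Re \o f),
      measurable_fun [set: R] (Im \o f) &
      (linf_norm f < +oo)%E]].

Lemma muT_gt0 : (0 < mu [set: R])%E.
Proof.
by rewrite -set_itvNyy lebesgue_measure_itv /= addye //; exact: ltry.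
Qed.

Lemma normc_ge0 (z : C) : 0 <= normc z.
Proof. by case: z => a b; rewrite sqrtr_ge0. Qed.

Lemma linf_normE (f : R -> C) :
  linf_norm f = ess_sup mu (fun t => (normc (f t))%:E).
Proof.
rewrite /linf_norm unlock muT_gt0; congr ess_sup.
by apply/funext => t /=; rewrite ger0_norm ?normc_ge0.
Qed.

Lemma linf_norm_lty (f : R -> C) : (linf_norm f < +oo)%E <->
  exists c : R, (linf_norm f <= c%:E)%E.
Proof.
split=> [|[c fc]]; last exact: le_lt_trans (ltry c).
case: (linf_norm f) => [r _|//|_]; first by exists r.
by exists 0; rewrite leNye.
Qed.

Lemma linfP (f : R -> C) : f \in linf <->
  [/\ periodic f (pi *+ 2),
      measurable_fun [set: R] (Re \o f),
      measurable_fun [set: R] (Im \o f) &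
      exists c : R, (linf_norm f <= c%:E)%E].
Proof.
rewrite inE /=; split=> -[? ? ? fb]; split=> //; exact/linf_norm_lty.
Qed.

Lemma linf_cst (z : C) : cst z \in linf.
Proof.
apply/linfP; split=> //; [exact: measurable_cst..|].
exists (normc z); rewrite linf_normE; apply/ess_supP.
exact: nearW.
Qed.

Lemma linf_subring_closed : subring_closed linf.
Proof.
split=> [|f g /linfP[pf mf1 mf2 [c fc]] /linfP[pg mg1 mg2 [d gd]]|
          f g /linfP[pf mf1 mf2 [c fc]] /linfP[pg mg1 mg2 [d gd]]].
- exact: linf_cst.
- apply/linfP; split.
  + by move=> t; rewrite /GRing.add /= /GRing.opp /= pf pg.
  + rewrite (_ : _ \o _ = (Re \o f) \- (Re \o g)).
      exact: measurable_funB.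
    by apply/funext => t /=; rewrite -raddfB.
  + rewrite (_ : _ \o _ = (Im \o f) \- (Im \o g)).
      exact: measurable_funB.
    by apply/funext => t /=; rewrite -raddfB.
  + exists (c + d); move: fc gd; rewrite !linf_normE.
    move=> /ess_supP fc /ess_supP gd; apply/ess_supP.
    move: fc gd; apply: filterS2 => t; rewrite !lee_fin => fc gd.
    apply: le_trans (le_normcD _ _) _.
    by rewrite lerD// -[leLHS]normcN opprK.
- apply/linfP; split.
  + by move=> t; rewrite /GRing.mul /= pf pg.
  + rewrite (_ : _ \o _ = ((Re \o f) \* (Re \o g)) \-
                          ((Im \o f) \* (Im \o g))).
      by apply: measurable_funB; exact: measurable_funM.
    apply/funext => t /=; rewrite /GRing.mul /=.
    by case: (f t) => a b; case: (g t).
  + rewrite (_ : _ \o _ = ((Re \o f) \* (Im \o g)) \+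
                          ((Im \o f) \* (Re \o g))).
      by apply: measurable_funD; exact: measurable_funM.
    apply/funext => t /=; rewrite /GRing.mul /=.
    by case: (f t) => a b; case: (g t).
  + exists (c * d); move: fc gd; rewrite !linf_normE.
    move=> /ess_supP fc /ess_supP gd; apply/ess_supP.
    move: fc gd; apply: filterS2 => t; rewrite !lee_fin => fc gd.
    by rewrite normcM ler_pM ?normc_ge0.
Qed.

Lemma linf_scaler_closed : scaler_closed linf.
Proof.
move=> z f flinf; have [_ _ mulP] := linf_subring_closed.
exact: (mulP (cst z) f (linf_cst z) flinf).
Qed.

HB.instance Definition _ := GRing.isSubringClosed.Build (R -> C^o) linf
  linf_subring_closed.
HB.instance Definition _ := GRing.isScaleClosed.Build C (R -> C^o) linf
  linf_scaler_closed.

Record Linf := MkLinf { linf_fun :> R -> C^o; _ : linf_fun \in linf }.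

HB.instance Definition _ := [isSub for linf_fun].
HB.instance Definition _ := [Choice of Linf by <:].
HB.instance Definition _ := [SubChoice_isSubComNzRing of Linf by <:].
HB.instance Definition _ := [SubZmodule_isSubLmodule of Linf by <:].

Definition char_fun (n : int) (t : R) : C :=
  cos (n%:~R * t) +i* sin (n%:~R * t).

Lemma cos_sin_periodz (n : int) (t : R) :
  cos (n%:~R * (t + pi *+ 2)) = cos (n%:~R * t) /\
  sin (n%:~R * (t + pi *+ 2)) = sin (n%:~R * t).
Proof.
have aux (m : nat) (x : R) : cos (x + m%:R * (pi *+ 2)) = cos x /\
    sin (x + m%:R * (pi *+ 2)) = sin x.
  by rewrite mulr_natl (periodicn (@cosD2pi R)) (periodicn (@sinD2pi R)).
case: n => m; rewrite mulrDr; first exact: aux.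
rewrite NegzE mulrNz !mulNr; set y := m.+1%:~R * _; set z := m.+1%:~R * _.
have [<- <-] := aux m.+1 (- y - z).
by rewrite -[m.+1%:R * _]/z subrK.
Qed.

Lemma char_fun_linf (n : int) : (char_fun n : R -> C^o) \in linf.
Proof.
have cont : continuous (fun t : R => n%:~R * t).
  by move=> t; apply: cvgM; [exact: cvg_cst|exact: cvg_id].
apply/linfP; split.
- by move=> t; rewrite /char_fun; have [-> ->] := cos_sin_periodz n t.
- apply: continuous_measurable_fun => t.
  exact: (continuous_comp (cont t) (@continuous_cos R _)).
- apply: continuous_measurable_fun => t.
  exact: (continuous_comp (cont t) (@continuous_sin R _)).
- exists 1; rewrite linf_normE; apply/ess_supP; apply: nearW => t.
  by rewrite lee_fin /char_fun /normc cos2Dsin2 sqrtr1.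
Qed.

Definition char (n : int) : Linf := MkLinf (char_fun_linf n).

Lemma lebesgue_measure_shift (x : R) (A : set R) : measurable A ->
  mu ((fun t => t - x) @^-1` A) = mu A.
Proof.
move=> mA.
have ms : measurable_fun [set: measurableTypeR R]
    ((fun t => t - x) : measurableTypeR R -> measurableTypeR R).
  by apply: measurable_funB => //; exact: measurable_cst.
rewrite -[LHS]/(pushforward mu
  ((fun t => t - x) : measurableTypeR R -> measurableTypeR R) A).
apply/esym/lebesgue_measure_unique => //= _ [[a b]] _ <-; rewrite /pushforward /=.
rewrite (_ : _ @^-1` _ = `]a + x, b + x]%classic); last first.
  by apply/seteqP; split=> t /=; rewrite !in_itv /= ltrBrDr lerBlDr.
by rewrite !lebesgue_measure_itv /= !lte_fin ltrD2r -!EFinD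
  opprD addrACA subrr addr0.
Qed.

Lemma translate_linf (x : R) (f : Linf) :
  ((fun t => f (t - x)) : R -> C^o) \in linf.
Proof.
have sx : continuous (fun t : R => t - x).
  by move=> t; apply: cvgB; [exact: cvg_id|exact: cvg_cst].
have /linfP[pf mf1 mf2 [c fc]] := valP f; apply/linfP; split.
- by move=> t; rewrite addrAC pf.
- exact: (measurableT_comp mf1 (continuous_measurable_fun sx)).
- exact: (measurableT_comp mf2 (continuous_measurable_fun sx)).
- exists c; move: fc; rewrite !linf_normE.
  move=> /ess_supP [N [mN N0 fN]]; apply/ess_supP.
  exists ((fun t => t - x) @^-1` N); split.
  + rewrite -[X in measurable X]setTI.
    exact: (continuous_measurable_fun sx).
  + by rewrite -[RHS]N0; exact: lebesgue_measure_shift.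
  + by move=> t /= ft; exact: fN.
Qed.

Definition translate (x : R) (f : Linf) : Linf := MkLinf (translate_linf x f).

Definition fourier (f : Linf) (n : int) : C :=
  let g := f * char (- n) in
  ((pi *+ 2)^-1)%:C *
    ((\int[mu]_(t in `[0, pi *+ 2]) Re (g t)) +i*
     (\int[mu]_(t in `[0, pi *+ 2]) Im (g t))).

Definition opnorm (M : {scalar Linf}) : \bar R :=
  ereal_sup [set (normc (M f))%:E | f in [set f : Linf | (linf_norm f <= 1)%E]].

(* The finiteness of [opnorm M] is the continuity of [M]; it forces [M f] to
   depend on the almost everywhere class of [f] only, so that [M] is a functional on
   the usual quotient space. *)
Definition invariant_mean (M : {scalar Linf}) : Prop :=
  [/\ M 1 = 1, opnorm M = 1%E & forall (f : Linf) (x : R), M (translate x f) = M f].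

Definition unique_invariant_mean (f : Linf) : Prop :=
  forall M : {scalar Linf}, invariant_mean M -> M f = fourier f 0.

Definition Linf_spec (L : set int) : set Linf :=
  [set f | forall n, ~ L n -> fourier f n = 0].

Definition lust_piquard (L : set int) : Prop :=
  forall (f : Linf) (n : int), Linf_spec L f -> unique_invariant_mean (char n * f).

End Linf.

(* Main.v *)
(** The set [H] consists of the integers whose base 4 digits at positions
    1, ..., n are all 1 or 2, the other digits being 0. An integer [a] has
    ultimately constant digits 0 or 3 (in the 4-adic sense for [a < 0]), so
    that the class of [a] modulo a large power of 4 meets [H] at most in [a].
    If [f] has its spectrum in [H] and [g = e_n f], averaging [g] over its
    translates by the multiples of [2 pi / 2^s], which changes no invariant
    mean, keeps only the frequencies divisible by [2^s]; for [s] large only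
    the frequency 0 remains, and the average is almost everywhere equal to
    the constant [fourier g 0], by uniqueness of the Fourier coefficients.

    For the uniqueness, if all the Fourier coefficients of [f] are 0, then so
    are those of [f * p] for each trigonometric polynomial [p]; indicator
    functions of intervals being bounded limits of such polynomials, the
    integrals of [f] over intervals are 0, and Lebesgue differentiation gives
    [f = 0] almost everywhere. *)
Require Import Defs.
From mathcomp Require Import all_boot all_order all_algebra.
From mathcomp Require Import all_classical all_reals.
From mathcomp Require Import all_analysis.
From mathcomp Require Import measurable_realfun ess_sup_inf complex.
From mathcomp Require Import ring lra zify.

Set Implicit Arguments.
Unset Strict Implicit.
Unset Printing Implicit Defensive.

Import Order.TTheory GRing.Theory Num.Theory.
Import numFieldNormedType.Exports.
Import Normc.

Local Open Scope classical_set_scope.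
Local Open Scope ring_scope.

(** * Integers with base 4 digits 1 and 2 *)

Definition digits12 (n : nat) (eps : nat -> bool) : nat :=
  (\sum_(1 <= k < n.+1) (1 + eps k) * 4 ^ k)%N.

Definition base4_hilbert : set int :=
  \bigcup_(n in [set n | (1 <= n)%N])
    [set (digits12 n eps)%:Z | eps in [set: nat -> bool]].

(** The constant parts 1 of the digits are collected in [p n], and [eps k] decides whether the digit
    at position [k] grows to 2. *)
Lemma hilbert_set_base4 : hilbert_set base4_hilbert.
Proof.
exists (fun n => \sum_(1 <= k < n.+1) 4 ^+ k), (fun k => 4 ^+ k).
split=> [n _|]; first by rewrite expf_neq0.
apply: eq_bigcupr => n _; apply: eq_imagel => eps _.
rewrite /digits12 -[LHS]natz natr_sum -big_split /=; apply: eq_bigr => k _.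
by rewrite natrM natrX natrD mulrDl mul1r.
Qed.

Lemma digits12_lt n eps : (digits12 n eps < 4 ^ n.+1)%N.
Proof.
(* This stronger bound, an equality when all digits are 2, is stable under the induction. *)
suff: (3 * digits12 n eps + 8 <= 2 * 4 ^ n.+1)%N by lia.
elim: n => [|n IHn]; first by rewrite /digits12 big_geq.
rewrite /digits12 big_nat_recr //= -/(digits12 n eps) (expnS 4 n.+1).
by case: (eps n.+1); lia.
Qed.

Lemma digits12_split i n eps : (i < n)%N ->
  exists z, digits12 n eps =
    (digits12 i eps + (1 + eps i.+1) * 4 ^ i.+1 + 4 ^ i.+2 * z)%N.
Proof.
move=> ltin; have /dvdnP[z zE] :
    (4 ^ i.+2 %| \sum_(i.+2 <= k < n.+1) (1 + eps k) * 4 ^ k)%N.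
  rewrite big_nat_cond; apply: dvdn_sum => k /andP[/andP[lik _] _].
  by rewrite dvdn_mull // dvdn_exp2l.
exists z; rewrite (mulnC _ z) -zE /digits12 (big_cat_nat (n := i.+2)) //=.
by rewrite [X in (X + _)%N]big_nat_recr.
Qed.

(* The base 4 digits of an integer are ultimately all equal to 0 or all
   equal to 3, those of the elements of [base4_hilbert] are 1 or 2. *)
Lemma base4_hilbert_isolated (a : int) : exists s : nat,
  forall x c : int, base4_hilbert x -> x = a + 2 ^+ s * c -> x = a.
Proof.
(* As |a| < 4^(i+1), the digits of [a] from position i+1 on are all 0 or all 3; the modulus 2^s =
   4^(i+2) is the smallest power of 4 that sees position i+1. *)
pose i := `|a|%N; exists (i.+2).*2 => x c [n /= _ [eps _ <-]].
have lt_a : (`|a| < 4 ^ i.+1)%N.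
  by rewrite (leq_trans (ltnSn _)) // ltnW // ltn_expl.
have -> : 2 ^+ (i.+2).*2 = (4 * 4 ^ i.+1)%N%:Z :> int.
  by rewrite -mul2n exprM -expnS -natz natrX.
(* For n <= i, both [x] and |a| are below 4^(i+1), so their difference is too small to be a nonzero
   multiple of 4^(i+2). *)
have [le_ni|lt_in] := leqP n i.
  have : (digits12 n eps < 4 ^ i.+1)%N.
    by rewrite (leq_trans (digits12_lt _ _)) // leq_exp2l.
  move: (4 ^ i.+1)%N (digits12 n eps) lt_a => P X lt_a ltX xE.
  have [c0|[c0|c0]] : c = 0 \/ 1 <= c \/ c <= -1 by lia.
  - by move: xE; rewrite c0; lia.
  - by nia.
  - by nia.
have [z ->] := digits12_split eps lt_in.
have := digits12_lt i eps; rewrite (expnS 4 i.+1).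
move: (4 ^ i.+1)%N (digits12 i eps) lt_a => P X lt_a ltX xE.
move: xE; set d := (1 + eps _)%N => xE.
have : (1 <= d <= 2)%N by rewrite /d; case: (eps _).
move: d xE => d xE /andP[d1 d2].
have PdE : (P <= d * P)%N /\ (d * P <= 2 * P)%N.
  by rewrite leq_mul2r d2 orbT leq_pmull.
move: (d * P)%N PdE xE => Q [? ?] xE.
(* With 0 <= X < P, P <= Q <= 2P and |a| < P, the left side lies strictly between 0 and 4P, so it
   cannot be a multiple of 4P. *)
have {xE}wE : (X + Q)%N%:Z - a = 4 * P%:Z * (c - z%:Z) by lia.
move: (c - z%:Z) wE => w wE.
have [w0|w1] : w <= 0 \/ 1 <= w by lia.
- have : P%:Z * w <= 0 by rewrite mulr_ge0_le0.
  lia.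
- have : P%:Z <= P%:Z * w by rewrite ler_peMr.
  lia.
Qed.

Lemma base4_hilbert_ge0 : base4_hilbert `<=` [set n : int | 0 <= n].
Proof. by move=> _ [n _ [eps _ <-]]. Qed.

(** * Fourier coefficients and translations *)

Section fourier_coefficients.
Local Open Scope complex_scope.
Variable R : realType.
Local Notation C := R[i].
Local Notation Re := (@complex.Re R).
Local Notation Im := (@complex.Im R).
Local Notation mu := (@lebesgue_measure R).
Implicit Types (u : R -> R) (f g : Linf R) (k n : int) (x t : R) (z : C).

(* The library's hints for these filters are stated on the [ringOfSetsType]
   carrier of the measure and miss predicates on the carrier [R]. *)
#[local] Hint Extern 0 (Filter _) =>
  (exact: (@ae_filter_ringOfSetsType _ _ _ mu)) : typeclass_instances.

Lemma normr_Re_le z : `|Re z| <= normc z.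
Proof.
by case: z => a b /=; rewrite -sqrtr_sqr ler_wsqrtr // lerDl sqr_ge0.
Qed.

Lemma normr_Im_le z : `|Im z| <= normc z.
Proof.
by case: z => a b /=; rewrite -sqrtr_sqr ler_wsqrtr // lerDr sqr_ge0.
Qed.

Lemma ae_bounded_integrable u (c : R) (A : set R) :
    measurable A -> (mu A < +oo)%E -> measurable_fun [set: R] u ->
    (\forall t \ae mu, `|u t| <= c) ->
  mu.-integrable A (EFin \o u).
Proof.
move=> mA fA mu_ uc; apply/integrableP; split.
  by apply/measurable_EFinP; exact: measurable_funTS.
have c0 : 0 <= c.
  have [t tc] : exists t, `|u t| <= c.
    have ae_proper := ae_properfilter_algebraOfSetsType (@muT_gt0 R).
    exact: (@filter_ex _ (almost_everywhere mu) ae_proper _ uc).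
  exact: le_trans tc.
apply: (@le_lt_trans _ _ (\int[mu]_(t in A) c%:E)%E); last first.
  by rewrite integral_cst //= lte_mul_pinfty // lee_fin.
apply: ae_ge0_le_integral => //.
- apply/measurable_EFinP; apply: measurableT_comp => //.
  exact: measurable_funTS.
- by move: uc; apply: filterS => t ut _; rewrite /= lee_fin.
Qed.

Lemma Linf_ae_bounded f : exists c : R, \forall t \ae mu, normc (f t) <= c.
Proof.
have /linfP[_ _ _ [c]] := valP f; rewrite linf_normE => /ess_supP fc.
by exists c.
Qed.

Lemma Linf_measurable_Re f : measurable_fun [set: R] (Re \o f).
Proof. by have /linfP[] := valP f. Qed.

Lemma Linf_measurable_Im f : measurable_fun [set: R] (Im \o f).
Proof. by have /linfP[] := valP f. Qed.

Lemma Linf_periodic f t : f (t + pi *+ 2) = f t.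
Proof. by have /linfP[pf _ _ _] := valP f; exact: pf. Qed.

Lemma Linf_integrable_Re f (A : set R) : measurable A -> (mu A < +oo)%E ->
  mu.-integrable A (EFin \o (Re \o f)).
Proof.
move=> mA fA; have [c fc] := Linf_ae_bounded f.
apply: (ae_bounded_integrable mA fA (Linf_measurable_Re f) (c := c)).
by apply: filterS fc => t; exact: le_trans (normr_Re_le _).
Qed.

Lemma Linf_integrable_Im f (A : set R) : measurable A -> (mu A < +oo)%E ->
  mu.-integrable A (EFin \o (Im \o f)).
Proof.
move=> mA fA; have [c fc] := Linf_ae_bounded f.
apply: (ae_bounded_integrable mA fA (Linf_measurable_Im f) (c := c)).
by apply: filterS fc => t; exact: le_trans (normr_Im_le _).
Qed.

Lemma lebesgue_measure_itvcc_lty (a b : R) : (mu `[a, b] < +oo)%E.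
Proof.
rewrite lebesgue_measure_itv /=; case: ifP => _; last exact: ltry.
by rewrite -EFinB ltry.
Qed.

Lemma integrable_EFinZ (A : set R) (c : R) u : measurable A ->
  mu.-integrable A (EFin \o u) -> mu.-integrable A (EFin \o (fun t => c * u t)).
Proof.
by move=> mA iu; rewrite (_ : _ \o _ = (cst c%:E \* (EFin \o u))%E) //;
  exact: integrableZl.
Qed.

Lemma integrable_EFinD (A : set R) u v : measurable A ->
  mu.-integrable A (EFin \o u) -> mu.-integrable A (EFin \o v) ->
  mu.-integrable A (EFin \o (fun t => u t + v t)).
Proof.
by move=> mA iu iv; rewrite (_ : _ \o _ = ((EFin \o u) \+ (EFin \o v))%E) //;
  exact: integrableD.
Qed.

Lemma integrable_EFinB (A : set R) u v : measurable A ->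
  mu.-integrable A (EFin \o u) -> mu.-integrable A (EFin \o v) ->
  mu.-integrable A (EFin \o (fun t => u t - v t)).
Proof.
by move=> mA iu iv; rewrite (_ : _ \o _ = ((EFin \o u) \- (EFin \o v))%E) //;
  exact: integrableB.
Qed.

Lemma char_funD k n t : char_fun (k + n) t = char_fun k t * char_fun n t.
Proof.
rewrite /char_fun intrD mulrDl cosD sinD /GRing.mul /=.
by congr (_ +i* _); rewrite addrC // addrC.
Qed.

Lemma char_fun0 t : char_fun 0 t = 1.
Proof. by rewrite /char_fun mul0r cos0 sin0. Qed.

Lemma char_funDt k x t : char_fun k (x + t) = char_fun k x * char_fun k t.
Proof.
rewrite /char_fun mulrDr cosD sinD /GRing.mul /=.
by congr (_ +i* _); rewrite addrC // addrC.
Qed.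

Lemma charD k n : char R (k + n) = char R k * char R n.
Proof. by apply: val_inj; apply/funext => t; exact: char_funD. Qed.

Lemma char0 : char R 0 = 1.
Proof. by apply: val_inj; apply/funext => t; exact: char_fun0. Qed.

Lemma Linf_scaleAl z f g : z *: (f * g) = (z *: f) * g.
Proof.
apply: val_inj; apply/funext => t.
have E : z * ((f t : C) * (g t : C)) = (z * (f t : C)) * (g t : C).
  by rewrite mulrA.
exact: E.
Qed.

Lemma fourier_mul_char f k n : fourier (char R n * f) k = fourier f (k - n).
Proof.
suff E : char R n * f * char R (- k) = f * char R (- (k - n)).
  by rewrite /fourier E.
by rewrite opprB charD mulrCA mulrA.
Qed.

(** Absorbing the character into the function reduces later proofs to plain integrals at frequency
    0. *)
Lemma fourierE f k : fourier f k = fourier (f * char R (- k)) 0.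
Proof. by rewrite {2}/fourier oppr0 char0 mulr1. Qed.

Lemma fourier_linear z f g k :
  fourier (z *: f + g) k = z * fourier f k + fourier g k.
Proof.
rewrite fourierE (fourierE f) (fourierE g).
rewrite mulrDl -Linf_scaleAl.
move: (f * _) (g * _) => {}f {}g.
rewrite /fourier oppr0 char0 !mulr1.
have mI : measurable `[0%R, (pi *+ 2 : R)] by [].
have fI := lebesgue_measure_itvcc_lty 0 (pi *+ 2).
have [iRf iIf] := (Linf_integrable_Re f mI fI, Linf_integrable_Im f mI fI).
have [iRg iIg] := (Linf_integrable_Re g mI fI, Linf_integrable_Im g mI fI).
case: z => a b.
have ReE (w y : C) :
    Re ((a +i* b) * w + y) = (a * Re w - b * Im w) + Re y.
  by case: w; case: y.
have ImE (w y : C) :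
    Im ((a +i* b) * w + y) = (a * Im w + b * Re w) + Im y.
  by case: w; case: y.
have -> : \int[mu]_(t in `[0, pi *+ 2])
    Re ((((a +i* b) *: f + g : Linf R) : R -> C) t) =
    (a * \int[mu]_(t in `[0, pi *+ 2]) Re (f t) -
     b * \int[mu]_(t in `[0, pi *+ 2]) Im (f t)) +
     \int[mu]_(t in `[0, pi *+ 2]) Re (g t).
  under eq_Rintegral do rewrite [X in Re X]/= ReE.
  have i1 : mu.-integrable `[0%R, (pi *+ 2 : R)]
      (EFin \o (fun t => a * Re (f t) - b * Im (f t))).
    by apply: integrable_EFinB => //; exact: integrable_EFinZ.
  rewrite RintegralD // RintegralB //; [|exact: integrable_EFinZ..].
  by rewrite !RintegralZl.
have -> : \int[mu]_(t in `[0, pi *+ 2])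
    Im ((((a +i* b) *: f + g : Linf R) : R -> C) t) =
    (a * \int[mu]_(t in `[0, pi *+ 2]) Im (f t) +
     b * \int[mu]_(t in `[0, pi *+ 2]) Re (f t)) +
     \int[mu]_(t in `[0, pi *+ 2]) Im (g t).
  under eq_Rintegral do rewrite [X in Im X]/= ImE.
  have i1 : mu.-integrable `[0%R, (pi *+ 2 : R)]
      (EFin \o (fun t => a * Im (f t) + b * Re (f t))).
    by apply: integrable_EFinD => //; exact: integrable_EFinZ.
  rewrite RintegralD // RintegralD //; [|exact: integrable_EFinZ..].
  by rewrite !RintegralZl.
by rewrite mulrCA -mulrDr.
Qed.

Lemma fourierD f g k : fourier (f + g) k = fourier f k + fourier g k.
Proof. by rewrite -[f in LHS]scale1r fourier_linear mul1r. Qed.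

Lemma fourier0 k : fourier (0 : Linf R) k = 0.
Proof.
have := fourier_linear (-1) (0 : Linf R) 0 k.
by rewrite scaler0 addr0 mulN1r addNr.
Qed.

Lemma fourierZ z f k : fourier (z *: f) k = z * fourier f k.
Proof. by rewrite -[_ *: _]addr0 fourier_linear fourier0 addr0. Qed.

(** * Translations and integrals over a period *)

Lemma Rintegral_shift u (a b x : R) : measurable_fun [set: R] u ->
    mu.-integrable `[a, b] (EFin \o (fun t => u (t - x))) ->
  \int[mu]_(t in `[a, b]) u (t - x) = \int[mu]_(t in `[a - x, b - x]) u t.
Proof.
move=> mu_ iu; congr fine.
have ms : measurable_fun [set: measurableTypeR R]
    ((fun t => t - x) : measurableTypeR R -> measurableTypeR R).
  by apply: measurable_funB => //; exact: measurable_cst.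
have sE : (fun t => t - x) @^-1` `[a - x, b - x] = `[a, b]%classic.
  by apply/seteqP; split=> t /=; rewrite !in_itv /= !lerD2r.
have mfs : measurable_fun [set: R] (u \o (fun t => t - x)).
  exact: (measurableT_comp mu_ ms).
have mE A : measurable A -> mu A = pushforward mu
    ((fun t => t - x) : measurableTypeR R -> measurableTypeR R) A.
  by move=> mA; rewrite /pushforward lebesgue_measure_shift.
rewrite -sE -[LHS](@integral_pushforward _ _ _ _ _ _ ms mu _ (EFin \o u)) //.
- by apply: eq_measure_integral => A mA _; exact/esym/mE.
- exact/measurable_EFinP.
- by rewrite sE.
Qed.

Lemma Rintegral_itv_cat u (a b c : R) : a <= b -> b <= c ->
    mu.-integrable `[a, c] (EFin \o u) ->
  \int[mu]_(t in `[a, c]) u t =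
  \int[mu]_(t in `[a, b]) u t + \int[mu]_(t in `[b, c]) u t.
Proof.
move=> ab bc iu; rewrite -[X in _ = _ + X]Rintegral_itv_obnd_cbnd; last first.
  apply: (integrableS _ _ _ iu) => //=; apply: subset_itvr.
  by rewrite bnd_simp.
rewrite -(@Rintegral_itvB _ u (BLeft a) (BRight c) b) ?bnd_simp //.
by rewrite addrC subrK.
Qed.

(** The shifted interval [-x, p - x] is cut at 0, and its left part is moved by one period onto
    [p - x, p]. *)
Lemma Rintegral_period u (p x : R) : 0 <= x <= p -> periodic u p ->
    measurable_fun [set: R] u ->
    (forall a b : R, mu.-integrable `[a, b] (EFin \o u)) ->
    (forall a b : R, mu.-integrable `[a, b] (EFin \o (fun t => u (t - x)))) ->
  \int[mu]_(t in `[0, p]) u (t - x) = \int[mu]_(t in `[0, p]) u t.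
Proof.
move=> /andP[x0 xp] pu mu_ iu iux; rewrite Rintegral_shift // sub0r.
rewrite (@Rintegral_itv_cat _ (- x) 0 (p - x)) ?oppr_le0 ?subr_ge0 //.
have -> : \int[mu]_(t in `[(- x)%R, 0%R]) u t =
    \int[mu]_(t in `[(p - x)%R, p]) u t.
  have up : (fun t => u (t - (- p))) = u by apply/funext => t; rewrite opprK pu.
  have := @Rintegral_shift u (- x) 0 (- p) mu_.
  by rewrite up opprK add0r (addrC (- x)) => ->.
by rewrite addrC -Rintegral_itv_cat // ?subr_ge0 // gerBl.
Qed.

(** Since e_{-k}(t) = e_{-k}(x) e_{-k}(t - x), the integrand is a constant times a translate of f
    e_{-k}, whose integral over a period is unchanged. *)
Lemma fourier_translate f x k : 0 <= x <= pi *+ 2 ->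
  fourier (translate x f) k = char_fun (- k) x * fourier f k.
Proof.
move=> xI; rewrite (fourierE (translate x f)) (fourierE f).
have -> : translate x f * char R (- k) =
    char_fun (- k) x *: translate x (f * char R (- k)).
  apply: val_inj; apply/funext => t.
  have E : (f (t - x) : C) * char_fun (- k) t =
      char_fun (- k) x * ((f (t - x) : C) * char_fun (- k) (t - x)).
    by rewrite mulrCA -char_funDt (addrC x) subrK.
  exact: E.
move: (f * _) => {}f; rewrite fourierZ.
suff -> : fourier (translate x f) 0 = fourier f 0 by [].
rewrite /fourier oppr0 char0 !mulr1.
have -> : \int[mu]_(t in `[0, pi *+ 2]) Re (translate x f t) =
    \int[mu]_(t in `[0, pi *+ 2]) Re (f t).
  apply: (@Rintegral_period (Re \o f)) => //.
  + by move=> t; rewrite /= Linf_periodic.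
  + exact: Linf_measurable_Re.
  + move=> a b; apply: Linf_integrable_Re => //.
    exact: lebesgue_measure_itvcc_lty.
  + move=> a b; apply: (Linf_integrable_Re (translate x f)) => //.
    exact: lebesgue_measure_itvcc_lty.
suff -> : \int[mu]_(t in `[0, pi *+ 2]) Im (translate x f t) =
    \int[mu]_(t in `[0, pi *+ 2]) Im (f t) by [].
apply: (@Rintegral_period (Im \o f)) => //.
- by move=> t; rewrite /= Linf_periodic.
- exact: Linf_measurable_Im.
- move=> a b; apply: Linf_integrable_Im => //.
  exact: lebesgue_measure_itvcc_lty.
- move=> a b; apply: (Linf_integrable_Im (translate x f)) => //.
  exact: lebesgue_measure_itvcc_lty.
Qed.

(** * Uniqueness of the Fourier coefficients *)

Definition vanishing f := forall k, fourier f k = 0.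

(** This property holds for characters and is stable under linear combinations and powers, so it
    reaches polynomials in [arc_poly] without expanding them. *)
Definition vanishing_multiplier g := forall f, vanishing f -> vanishing (f * g).

Lemma vanishing_multiplier_char n : vanishing_multiplier (char R n).
Proof. by move=> f f0 k; rewrite mulrC fourier_mul_char. Qed.

Lemma vanishing_multiplierZD z f g : vanishing_multiplier f ->
  vanishing_multiplier g -> vanishing_multiplier (z *: f + g).
Proof.
move=> mf mg h h0 k.
rewrite mulrDr (mulrC h) -Linf_scaleAl (mulrC f) fourier_linear mf // mg //.
by rewrite mulr0 addr0.
Qed.

Lemma vanishing_multiplier1 : vanishing_multiplier 1.
Proof. by move=> f f0; rewrite mulr1. Qed.

Lemma vanishing_multiplierX g m : vanishing_multiplier g ->
  vanishing_multiplier (g ^+ m).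
Proof.
move=> mg; elim: m => [|m IHm]; first exact: vanishing_multiplier1.
by move=> f f0; rewrite exprS mulrA; apply: IHm; exact: mg.
Qed.

Lemma Linf_exprE f m t : (f ^+ m : Linf R) t = (f t : C) ^+ m.
Proof.
elim: m => [//|m IHm]; rewrite !exprS -IHm; exact: erefl.
Qed.

(* By [arc_val_prod], [arc_val b] is a trigonometric polynomial with values in
   [[0, 1]] which on [[0, 2 pi]] is less than 1/2 exactly on the open interval
   from 0 to [b]. *)
Definition arc_val (b t : R) : R := 2^-1 + (cos (b / 2) - cos (t - b / 2)) / 4.

(** Euler's formula splits cos(t - b/2) into the frequencies 1 and -1. The final [+ 0] gives every
    term the shape expected by [vanishing_multiplierZD]. *)
Definition arc_poly (b : R) : Linf R :=
  (- (8^-1 * char_fun (- 1) (b / 2))) *: char R 1 +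
  ((- (8^-1 * char_fun 1 (b / 2))) *: char R (- 1) +
  ((2^-1 + cos (b / 2) / 4)%:C *: (1 : Linf R) + 0)).

Lemma arc_polyE b t : arc_poly b t = (arc_val b t)%:C.
Proof.
have -> : arc_poly b t = - (8^-1 * char_fun (- 1) (b / 2)) * char_fun 1 t +
  (- (8^-1 * char_fun 1 (b / 2)) * char_fun (- 1) t +
  ((2^-1 + cos (b / 2) / 4)%:C * 1 + 0)) by [].
have -> : 8^-1 = (8^-1)%:C :> C by rewrite rmorphV ?unitfE //= rmorph_nat.
rewrite /char_fun /arc_val !mulrN1z !mulr1z cosB !mulN1r !cosN !sinN.
by apply/eqP; rewrite eq_complex /=; apply/andP; split; apply/eqP;
  rewrite /= !mul1r; field.
Qed.

(** The product form makes the sign visible: for 0 < t < 2 pi the first sine is positive and the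
    second has the sign of t - b. *)
Lemma arc_val_prod b t :
  arc_val b t = 2^-1 + sin (t / 2) * sin ((t - b) / 2) / 2.
Proof.
rewrite /arc_val; congr (_ + _).
have -> : b / 2 = t / 2 - (t - b) / 2 by field.
have -> : t - (t / 2 - (t - b) / 2) = t / 2 + (t - b) / 2 by field.
by rewrite cosB cosD; field.
Qed.

Lemma arc_val_itv b t : 0 <= arc_val b t <= 1.
Proof.
have := cos_le1 (b / 2); have := cos_geN1 (b / 2).
have := cos_le1 (t - b / 2); have := cos_geN1 (t - b / 2).
by rewrite /arc_val => ? ? ? ?; apply/andP; split; lra.
Qed.

(* These polynomials, from the elementary proof of the Stone-Weierstrass
   theorem, converge boundedly on [[0, 1]], off 1/2, to the indicator function
   of [r < 1/2]. *)
Definition step_val (m : nat) (r : R) : R := (1 - r ^+ m) ^+ (2 ^ m).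

Lemma step_val_itv m (r : R) : 0 <= r <= 1 -> 0 <= step_val m r <= 1.
Proof.
move=> /andP[r0 r1]; have rm0 : 0 <= r ^+ m by rewrite exprn_ge0.
have rm1 : r ^+ m <= 1 by rewrite exprn_ile1.
by rewrite /step_val exprn_ge0 ?subr_ge0 //= exprn_ile1 ?subr_ge0 ?gerBl.
Qed.

Lemma bernoulli_le (y : R) m : -1 <= y -> 1 + m%:R * y <= (1 + y) ^+ m.
Proof.
move=> y1; elim: m => [|m IHm]; first by rewrite mul0r addr0 expr0.
rewrite exprS -natr1; apply: (@le_trans _ _ ((1 + y) * (1 + m%:R * y))).
  rewrite -subr_ge0 (_ : _ - _ = m%:R * (y * y)); last by ring.
  by rewrite mulr_ge0 // -expr2 sqr_ge0.
by rewrite ler_wpM2l //; lra.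
Qed.

(** Bernoulli's inequality gives (1 - r^m)^(2^m) >= 1 - (2r)^m. *)
Lemma cvg_step_val_lt (r : R) :
  0 <= r < 2^-1 -> step_val m r @[m --> \oo] --> (1 : R).
Proof.
move=> /andP[r0 r2].
have r21 : `|2 * r| < 1 by rewrite ger0_norm; lra.
apply: (@squeeze_cvgr _ _ _ _ (fun m => 1 - (2 * r) ^+ m) (fun=> 1)).
- apply: nearW => m; have rI : 0 <= r <= 1 by apply/andP; split; lra.
  have /andP[_ ->] := step_val_itv m rI; rewrite andbT.
  have := @bernoulli_le (- r ^+ m) (2 ^ m)%N.
  rewrite mulrN natrX -exprMn; apply.
  by rewrite lerN2 exprn_ile1; lra.
- rewrite -[X in _ --> X]subr0; apply: cvgB; first exact: cvg_cst.
  exact: cvg_expr.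
- exact: cvg_cst.
Qed.

(** The product of (1 - r^m)^(2^m) and (1 + r^m)^(2^m) is at most 1, and by Bernoulli the second
    factor is at least (2r)^m. *)
Lemma cvg_step_val_gt (r : R) :
  2^-1 < r <= 1 -> step_val m r @[m --> \oo] --> (0 : R).
Proof.
move=> /andP[r2 r1].
have r21 : `|(2 * r)^-1| < 1.
  by rewrite normfV ger0_norm; [rewrite invf_lt1; lra|lra].
apply: (@squeeze_cvgr _ _ _ _ (fun=> 0) (fun m => (2 * r)^-1 ^+ m)).
- apply: nearW => m; have rI : 0 <= r <= 1 by apply/andP; split; lra.
  have /andP[-> _] /= := step_val_itv m rI.
  have rn0 : 0 <= r ^+ m by rewrite exprn_ge0; lra.
  have rn1 : r ^+ m <= 1 by rewrite exprn_ile1; lra.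
  rewrite exprVn -[leRHS]mul1r ler_pdivlMr; last by rewrite exprn_gt0; lra.
  apply: (@le_trans _ _ (step_val m r * (1 + r ^+ m) ^+ (2 ^ m))).
    rewrite ler_wpM2l //; first by have /andP[] := step_val_itv m rI.
    apply: le_trans (bernoulli_le _ _); last by lra.
    by rewrite natrX -exprMn lerDr.
  rewrite /step_val -exprMn exprn_ile1 //.
    by rewrite mulr_ge0; lra.
  by rewrite -subr_sqr expr1n gerBl sqr_ge0.
- exact: cvg_cst.
- exact: cvg_expr.
Qed.

Lemma arc_val_lt b t : 0 < t < b -> b < pi *+ 2 -> arc_val b t < 2^-1.
Proof.
move=> /andP[t0 tb] b2; rewrite arc_val_prod gtrDl pmulr_llt0 ?invr_gt0 //.
have b2' : b / 2 < pi by rewrite ltr_pdivrMr // mulr_natr.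
rewrite pmulr_rlt0.
  rewrite -oppr_gt0 -sinN; apply: sin_gt0_pi; apply/andP; split; lra.
by apply: sin_gt0_pi; apply/andP; split; lra.
Qed.

Lemma arc_val_gt b t : 0 < b < t -> t < pi *+ 2 -> 2^-1 < arc_val b t.
Proof.
move=> /andP[b0 bt] t2; rewrite arc_val_prod ltrDl.
have t2' : t / 2 < pi by rewrite ltr_pdivrMr // mulr_natr.
by rewrite !mulr_gt0 ?invr_gt0 //; apply: sin_gt0_pi; apply/andP; split; lra.
Qed.

(** * From vanishing coefficients to vanishing integrals *)

Lemma vanishing_arc_poly (b : R) m :
  vanishing_multiplier ((1 - arc_poly b ^+ m) ^+ (2 ^ m)).
Proof.
have m0 : vanishing_multiplier (0 : Linf R).
  by move=> f f0 k; rewrite mulr0 fourier0.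
have mb : vanishing_multiplier (arc_poly b).
  apply: vanishing_multiplierZD; first exact: vanishing_multiplier_char.
  apply: vanishing_multiplierZD; first exact: vanishing_multiplier_char.
  by apply: vanishing_multiplierZD; [exact: vanishing_multiplier1|exact: m0].
apply: vanishing_multiplierX.
have -> : 1 - arc_poly b ^+ m = -1 *: arc_poly b ^+ m + 1.
  by rewrite scaleN1r addrC.
apply: vanishing_multiplierZD; last exact: vanishing_multiplier1.
exact: vanishing_multiplierX.
Qed.

Lemma step_polyE (b : R) m t :
  ((1 - arc_poly b ^+ m) ^+ (2 ^ m) : Linf R) t = (step_val m (arc_val b t))%:C.
Proof.
have E : (1 - arc_poly b ^+ m : Linf R) t = (1 - arc_val b t ^+ m)%:C :> C.
  have -> : (1 - arc_poly b ^+ m : Linf R) t =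
    1 - (arc_poly b ^+ m : Linf R) t by [].
  by rewrite Linf_exprE arc_polyE rmorphB rmorph1 rmorphXn.
by rewrite Linf_exprE E -rmorphXn.
Qed.

Lemma fourier_eq0_Re f : fourier f 0 = 0 ->
  \int[mu]_(t in `[0, pi *+ 2]) Re (f t) = 0.
Proof.
rewrite /fourier oppr0 char0 mulr1 => /eqP; rewrite mulf_eq0 => /orP[|].
  rewrite eq_complex /= => /andP[].
  by rewrite invr_eq0 mulrn_eq0 /= gt_eqF // pi_gt0.
by rewrite eq_complex => /andP[/eqP].
Qed.

Lemma vanishing_Re_step f (b : R) m : vanishing f ->
  \int[mu]_(t in `[0, pi *+ 2]) (Re (f t) * step_val m (arc_val b t)) = 0.
Proof.
move=> f0; have ReM (z : C) (r : R) : Re (z * r%:C) = Re z * r.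
  by case: z => ? ? /=; rewrite mulr0 subr0.
have <- : (fun t => Re ((f * (1 - arc_poly b ^+ m) ^+ (2 ^ m) : Linf R) t)) =
    (fun t => Re (f t) * step_val m (arc_val b t)).
  by apply/funext => t; rewrite -ReM -step_polyE.
exact: fourier_eq0_Re (vanishing_arc_poly b m f0 0).
Qed.

Lemma measurable_step_val (b : R) m :
  measurable_fun [set: R] (fun t => step_val m (arc_val b t)).
Proof.
have := Linf_measurable_Re ((1 - arc_poly b ^+ m) ^+ (2 ^ m)).
congr measurable_fun; apply/funext => t; exact: (congr1 Re (step_polyE b m t)).
Qed.

Lemma vanishing_Re_itv f (b : R) : vanishing f -> 0 < b < pi *+ 2 ->
  \int[mu]_(t in `[0, b]) Re (f t) = 0.
Proof.
move=> f0 /andP[b0 b2].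
have mI : measurable `[0%R, (pi *+ 2 : R)] by [].
have fI := lebesgue_measure_itvcc_lty 0 (pi *+ 2 : R).
have iRf := Linf_integrable_Re f mI fI.
pose F m t := (Re (f t) * step_val m (arc_val b t))%:E.
pose G t := (((Re \o f) \_ `[0, b]) t)%:E.
have mF m : measurable_fun `[0%R, (pi *+ 2 : R)] (F m).
  apply/measurable_EFinP/measurable_funM; apply: measurable_funTS.
    exact: Linf_measurable_Re.
  exact: measurable_step_val.
have mG : measurable_fun `[0%R, (pi *+ 2 : R)] G.
  apply/measurable_EFinP/measurable_funTS.
  apply: (measurable_restrictT _ _).1; first exact: measurable_itv.
  exact: measurable_funTS (Linf_measurable_Re f).
have FG : \forall t \ae mu, [set` `[0%R, (pi *+ 2 : R)]] t ->
    F m t @[m --> \oo] --> G t.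
  (* At 0, b and 2 pi the value of [arc_val] is 1/2, where [step_val] tends to neither 0 nor 1;
     these points are discarded. *)
  have neq (a : R) : \forall t \ae mu, t <> a.
    exists [set a]; split.
    - exact: measurable_set1.
    - exact: lebesgue_measure_set1.
    - by move=> t /contrapT.
  move: (neq 0) (neq b) (neq (pi *+ 2)).
  apply: filterS3 => t /eqP t0 /eqP tb /eqP t2.
  rewrite /= in_itv /= => /andP[t0' t2'].
  have {t0 t0'}t0 : 0 < t by rewrite lt_def t0.
  have {t2 t2'}t2 : t < pi *+ 2 by rewrite lt_def eq_sym t2.
  apply/cvg_EFin; first by apply: nearW.
  rewrite /G /F /= patchE; case: ifPn.
    rewrite inE /= in_itv /= => /andP[_ tb'].
    rewrite -[X in _ --> X]mulr1; apply: cvgM; first exact: cvg_cst.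
    apply: cvg_step_val_lt.
    have /andP[-> _] := arc_val_itv b t; apply: arc_val_lt => //.
    by rewrite t0 lt_def eq_sym tb.
  rewrite notin_setE /= in_itv /= (ltW t0) /= => /negP; rewrite -ltNge => bt.
  rewrite -[X in _ --> X](mulr0 (Re (f t))); apply: cvgM; first exact: cvg_cst.
  apply: cvg_step_val_gt.
  have /andP[_ ->] := arc_val_itv b t; rewrite andbT; apply: arc_val_gt => //.
  by rewrite b0.
have dom : \forall t \ae mu, forall m, [set` `[0%R, (pi *+ 2 : R)]] t ->
    (`|F m t| <= `|(Re (f t))%:E|)%E.
  apply: aeW => t m _; rewrite /F lee_fin normrM ler_piMr // ger0_norm.
    by have /andP[] := step_val_itv m (arc_val_itv b t).
  by have /andP[] := step_val_itv m (arc_val_itv b t).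
have [_ _] := @dominated_convergence _ _ _ mu _ mI F G _ mF mG FG
  (integrable_abse iRf) dom.
(* Each [F m] has integral 0 by [vanishing_Re_step], so dominated convergence makes the integral of
   [G] the limit of a zero sequence. *)
rewrite (_ : (fun _ => _) = cst 0%E).
  move=> /(cvg_lim (@ereal_hausdorff R)); rewrite lim_cst //.
  move=> G0.
  transitivity (\int[mu]_(t in `[0, pi *+ 2]) ((Re \o f) \_ `[0, b]) t).
    rewrite -Rintegral_mkcondr setIidr // => t; rewrite /= !in_itv /=.
    by move=> /andP[-> tb]; rewrite (le_trans tb) // ltW.
  by rewrite -[LHS]/(fine (\int[mu]_(t in `[0%R, (pi *+ 2)%R]) G t)%E) -G0.
apply/funext => m /=; rewrite -[LHS]fineK; last first.
  apply: integrable_fin_num => //.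
  apply: (le_integrable _ _ _ (integrable_abse iRf)) => //.
    exact: mF.
  move=> t _; rewrite /= lee_fin normrM normr_id ler_piMr // ger0_norm.
    by have /andP[] := step_val_itv m (arc_val_itv b t).
  by have /andP[] := step_val_itv m (arc_val_itv b t).
by congr (_%:E); exact: vanishing_Re_step.
Qed.

(** * Vanishing almost everywhere, on one period and then on the line *)

Lemma vanishing_Re_ae0 f : vanishing f ->
  \forall t \ae mu, 0 < t < pi *+ 2 -> Re (f t) = 0.
Proof.
move=> f0; have i y : mu.-integrable `[0%R, y] (EFin \o (Re \o f)).
  by apply: Linf_integrable_Re => //; exact: lebesgue_measure_itvcc_lty.
have li : locally_integrable [set: R] (Re \o f).
  split; [exact: Linf_measurable_Re|exact: openT|move=> K _ cK].
  have /integrableP[] // : mu.-integrable K (EFin \o (Re \o f)).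
  apply: Linf_integrable_Re; last exact: compact_finite_measure.
  by apply: closed_measurable; exact: compact_closed.
have := FTC1 (a := BLeft 0) i li; apply: filterS => x Dx /andP[x0 x2].
have [|_] := Dx; first by rewrite /= lte_fin.
(* The primitive of Re f from 0 vanishes at all points near [x], hence so does its derivative at
   [x]. *)
rewrite /= => <-; rewrite derive1E (near_eq_derive (g := cst 0)) ?derive_cst //.
near=> y; apply: vanishing_Re_itv => //.
apply/andP; split; near: y; [exact: lt_nbhsr|exact: lt_nbhsl].
Unshelve. all: by end_near. Qed.

Lemma vanishing_ae0_period f : vanishing f ->
  \forall t \ae mu, 0 < t < pi *+ 2 -> f t = 0 :> C.
Proof.
(* The real part of -i f is Im f. *)
move=> f0; have g0 : vanishing (- 'i *: f).
  by move=> k; rewrite fourierZ f0 mulr0.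
move: (vanishing_Re_ae0 f0) (vanishing_Re_ae0 g0).
apply: filterS2 => t Re0 Im0 tI.
have : Re (- 'i * (f t : C)) = 0 by exact: Im0.
have := Re0 tI; case: (f t : C) => a b /= -> {Re0 Im0}.
by rewrite oppr0 mul0r sub0r mulN1r opprK => ->.
Qed.

Lemma Linf_periodicz f k t : f (t + k%:~R * (pi *+ 2)) = f t.
Proof.
have per m x : f (x + m%:R * (pi *+ 2)) = f x.
  rewrite mulr_natl; elim: m x => [|m IHm] x; first by rewrite mulr0n addr0.
  by rewrite mulrS addrA IHm Linf_periodic.
case: k => m; first exact: per.
by rewrite NegzE mulrNz mulNr -(per m.+1) subrK.
Qed.

Lemma vanishing_ae0 f : vanishing f -> \forall t \ae mu, f t = 0 :> C.
Proof.
move=> f0; have [N [mN N0 subN]] := vanishing_ae0_period f0.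
(* The point 0 is added because the previous lemma covers only the open period, whereas the
   translates of [0, 2 pi) tile the line. *)
pose Z := N `|` [set 0].
have mZ : measurable Z by apply: measurableU.
have Z0 : mu Z = 0%E.
  by rewrite null_set_setU //; exact: lebesgue_measure_set1.
pose S (k : int) := (fun t => t - k%:~R * (pi *+ 2)) @^-1` Z.
have nS k : mu.-negligible (S k).
  exists (S k); split => //; last first.
    by rewrite -[RHS]Z0; exact: lebesgue_measure_shift.
  rewrite -[X in measurable X]setTI; apply: measurable_funB => //.
have [U [mU U0 subU]] : mu.-negligible (\bigcup_m (S m%:Z `|` S (- m%:Z))).
  by apply: negligible_bigcup => m; exact: negligibleU.
exists U; split=> // t /= ft; apply: subU; pose k := Num.floor (t / (pi *+ 2)).
have p0 : 0 < pi *+ 2 :> R by rewrite mulrn_wgt0 // pi_gt0.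
have : S k t.
  rewrite /S /= /Z; set s := t - _.
  have s0 : 0 <= s by rewrite subr_ge0 -ler_pdivlMr // floor_le.
  have s2 : s < pi *+ 2.
    rewrite ltrBlDl -[X in _ < _ + X]mul1r -mulrDl -ltr_pdivrMr //.
    by have := floorD1_gt (t / (pi *+ 2)); rewrite intrD.
  have [->|sn0] := eqVneq s 0; [by right|left].
  apply: subN => /= h; apply: ft.
  rewrite -(Linf_periodicz f (- k)) mulrNz mulNr.
  by apply: h; rewrite s2 lt_def sn0 s0.
case: k => m Sm; first by exists m => //; left.
by exists m.+1 => //; right; rewrite -NegzE.
Qed.

(** * Averages of translates *)

Lemma char_fun_even_pi n : char_fun 1 ((2 * n)%:~R * pi : R) = 1.
Proof.
have [c s] := @cos_sin_periodz R n 0; move: c s; rewrite add0r mulr0 cos0 sin0.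
have -> : (2 * n)%:~R * pi = n%:~R * (pi *+ 2) :> R.
  by rewrite -(mulr_natl pi) intrM; ring.
by rewrite /char_fun mulr1z mul1r => -> ->.
Qed.

Lemma char_fun_odd_pi n : char_fun 1 ((2 * n + 1)%:~R * pi : R) = -1.
Proof.
rewrite intrD mulrDl char_funDt char_fun_even_pi !mul1r.
by rewrite /char_fun mulr1z mul1r cospi sinpi /GRing.opp /GRing.one /= oppr0.
Qed.

Lemma char_funE k t : char_fun k t = char_fun 1 (k%:~R * t).
Proof. by rewrite /char_fun mulr1z mul1r. Qed.

(** The constant 1 is fixed by the translation by pi / |k|, which multiplies the coefficient at [k]
    by -1. *)
Lemma fourier1_eq0 k : k != 0 -> fourier (1 : Linf R) k = 0.
Proof.
move=> k0; pose x : R := pi / `|k|%:~R.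
have k1 : 1 <= `|k|%:~R :> R by rewrite ler1z -gtz0_ge1 normr_gt0.
have kN0 : `|k|%:~R != 0 :> R by rewrite gt_eqF // (lt_le_trans ltr01).
have p0 := pi_gt0 R.
have xI : 0 <= x <= pi *+ 2.
  rewrite divr_ge0 ?(ltW p0) ?(le_trans ler01 k1) //=.
  rewrite ler_pdivrMr ?(lt_le_trans ltr01 k1) // mulr2n; nra.
have e1 : char_fun (- k) x = -1.
  rewrite char_funE; have [k0'|k0'] := leP 0 k.
    rewrite -(char_fun_odd_pi (-1)); congr (char_fun 1 _).
    by rewrite /x ger0_norm // in kN0 *; rewrite mulrNz; field.
  rewrite -(char_fun_odd_pi 0); congr (char_fun 1 _).
  by rewrite /x ltr0_norm // in kN0 *; rewrite mulrC divfK // mulr0 add0r mul1r.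
have E : translate x (1 : Linf R) = 1 by apply: val_inj.
have := fourier_translate 1 k xI; rewrite E e1 mulN1r => /eqP.
by rewrite -addr_eq0 -mulr2n mulrn_eq0 /= => /eqP.
Qed.

Lemma fourier1_0 : fourier (1 : Linf R) 0 = 1.
Proof.
rewrite /fourier oppr0 char0 mulr1.
have p0 : 0 < pi *+ 2 :> R by rewrite mulrn_wgt0 // pi_gt0.
have -> : \int[mu]_(t in `[0, pi *+ 2]) Re ((1 : Linf R) t) = pi *+ 2.
  rewrite -[LHS]/(\int[mu]_(t in `[0, pi *+ 2]) 1) Rintegral_cst // mul1r.
  have muI : mu `[0%R, (pi *+ 2 : R)] = (pi *+ 2)%:E.
    by rewrite lebesgue_measure_itv /= lte_fin p0 oppr0 adde0.
  exact: (congr1 fine muI).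
have -> : \int[mu]_(t in `[0, pi *+ 2]) Im ((1 : Linf R) t) = 0.
  by rewrite -[LHS]/(\int[mu]_(t in `[0, pi *+ 2]) 0) Rintegral_cst // mul0r.
by rewrite -[_ +i* 0]/((pi *+ 2)%:C) -rmorphM mulVf ?gt_eqF.
Qed.

(** Every multiple of [f] has seminorm at most 1, so boundedness of [M] gives r |M f| <= 1 for all r
    >= 0. *)
Lemma invariant_mean_ae0 (M : {scalar Linf R}) f : invariant_mean M ->
  (\forall t \ae mu, f t = 0 :> C) -> M f = 0.
Proof.
move=> [_ M1 _] f0; apply: eq0_normc.
have leM (r : R) : 0 <= r -> r * normc (M f) <= 1.
  move=> r0; have -> : r * normc (M f) = normc (M (r%:C *: f)).
    by rewrite linearZ normcM /= expr0n addr0 sqrtr_sqr ger0_norm.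
  rewrite -lee_fin -M1; apply: ereal_sup_ubound; exists (r%:C *: f) => //=.
  rewrite linf_normE; apply/ess_supP; apply: filterS f0 => t ft.
  suff : ((normc (r%:C * (f t : C)))%:E <= 1)%E by [].
  by rewrite ft mulr0 lee_fin /= expr0n addr0 sqrtr0.
apply/eqP; rewrite eq_le normc_ge0 andbT leNgt; apply/negP => M0.
have h : 0 <= 2 / normc (M f) by rewrite divr_ge0 // ltW.
by have := leM _ h; rewrite divfK ?gt_eqF //; lra.
Qed.

(* Averaging over the translates by the multiples of 2 pi / 2^s keeps exactly
   the frequencies divisible by 2^s. *)
Lemma average_translates s f : exists g,
  (forall M : {scalar Linf R}, invariant_mean M -> M g = M f) /\
  (forall k, fourier g k = if (2 ^+ s %| k)%Z then fourier f k else 0).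
Proof.
elim: s => [|s [g [Mg gE]]]; first by exists f; split=> // k; rewrite dvd1z.
(* On a remaining frequency l 2^s this translation acts as (-1)^l, so the mean of [g] and its
   translate keeps even [l] and kills odd [l]. *)
pose x : R := pi *+ 2 / 2 ^+ s.+1.
have p0 := pi_gt0 R.
have xE : x = pi / 2 ^+ s.
  by rewrite /x exprS -mulr_natr; field; rewrite expf_neq0.
have pp0 : 0 <= pi *+ 2 :> R by rewrite mulrn_wge0 // ltW.
have xI : 0 <= x <= pi *+ 2.
  rewrite /x divr_ge0 ?exprn_ge0 //= ler_pdivrMr ?exprn_gt0 // ler_peMr //.
  by rewrite exprn_ege1 // ler1n.
exists (2^-1 *: (g + translate x g)); split=> [M iM|k].
  have [_ _ MT] := iM.
  have -> : M (2^-1 *: (g + translate x g)) = 2^-1 * (M g + M (translate x g)).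
    by rewrite linearZ linearD.
  by rewrite MT (Mg M iM) -mulr2n -(mulr_natl (M f)) mulKf // pnatr_eq0.
rewrite fourierZ fourierD fourier_translate // gE exprS.
case: ifPn => [/dvdzP[l ->]|]; last first.
  rewrite mulr0 addr0 mulr0; case: ifPn => // /dvdzP[l ->] /negP[].
  by rewrite mulrA dvdz_mull.
rewrite dvdz_mul2r ?expf_neq0 // char_funE.
have -> : (- (l * 2 ^+ s))%:~R * x = (- l)%:~R * pi.
  rewrite xE -mulNr intrM rmorphXn /=.
  by rewrite -mulrA [X in _ * X]mulrC divfK ?expf_neq0.
have [m [->|->]] : exists m : int, l = 2 * m \/ l = 2 * m + 1.
  by exists (l %/ 2)%Z; lia.
- rewrite -mulrN char_fun_even_pi dvdz_mulr // mul1r.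
  rewrite -mulr2n -(mulr_natl (fourier _ _)).
  by rewrite mulKf.
- have -> : - (2 * m + 1) = 2 * (- m - 1) + 1 by ring.
  rewrite char_fun_odd_pi mulN1r subrr mulr0; case: ifPn => //.
  by move=> /dvdzP[l']; lia.
Qed.

Lemma lust_piquard_isolated (L : set int) :
    (forall a : int, exists s : nat,
      forall x c : int, L x -> x = a + 2 ^+ s * c -> x = a) ->
  lust_piquard R L.
Proof.
(* Isolation is used at -n because the coefficient of e_n f at [k] is that of [f] at k - n. *)
move=> isoL f n fL M iM; have [s Ls] := isoL (- n).
have [g [Mg gE]] := average_translates s (char R n * f).
pose c := fourier (char R n * f) 0.
have h0 : vanishing (g - c *: (1 : Linf R)).
  move=> k; rewrite fourierD -scaleN1r !fourierZ mulN1r gE.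
  have [->|k0] := eqVneq k 0.
    by rewrite dvdz0 fourier1_0 mulr1 subrr.
  (* For k = 2^s l with k - n in [L], isolation would give k - n = -n, against k != 0. *)
  rewrite fourier1_eq0 // mulr0 subr0; case: ifPn => // /dvdzP[l kE].
  rewrite fourier_mul_char; apply: fL => Lk; move/negP: k0; apply.
  apply/eqP/(addIr (- n)); rewrite add0r; apply: (Ls _ l Lk).
  by rewrite kE addrC (mulrC l).
have := invariant_mean_ae0 iM (vanishing_ae0 h0).
have [M1 _ _] := iM.
have -> : M (g - c *: (1 : Linf R)) = M g - c * M 1 by rewrite linearB linearZ.
by rewrite M1 mulr1 (Mg M iM) => /eqP; rewrite subr_eq0 => /eqP.
Qed.

End fourier_coefficients.

Theorem theorem4p2 (R : realType) :
  exists H : set int,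
    [/\ hilbert_set H, H `<=` [set n : int | 0 <= n] & lust_piquard R H].
Proof.
exists base4_hilbert; split.
- exact: hilbert_set_base4.
- exact: base4_hilbert_ge0.
- exact/lust_piquard_isolated/base4_hilbert_isolated.
Qed.
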